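(* Let $n,n_c,n_d$ be positive integers, $m=n_cn_d$, and $h>0$. Let $\boldsymbol{Q}\in\mathbb{R}^{n\times n}$ be symmetric positive definite, $\boldsymbol{b}\in\mathbb{R}^n$, $\tilde{\boldsymbol{\phi}}\in\mathbb{R}^m$, and let $\boldsymbol{K}\in\mathbb{R}^{m\times m}$ be a positive definite diagonal matrix. For each contact $i\in\{1,\dots,n_c\}$ let $\mu_i\ge 0$ be a friction coefficient, $\boldsymbol{n}_i\in\mathbb{R}^3$ the unit contact normal, and $\boldsymbol{d}_{i,1},\dots,\boldsymbol{d}_{i,n_d}\in\mathbb{R}^3$ unit vectors in the contact tangential plane. Let $\tilde{\boldsymbol{J}}\in\mathbb{R}^{m\times n}$ be the matrix whose rows, indexed by pairs $(i,j)$, are $\boldsymbol{J}^n_i-\mu_i\boldsymbol{J}^d_{i,j}$, where $\boldsymbol{J}^n_i,\boldsymbol{J}^d_{i,j}\in\mathbb{R}^{1\times n}$ are the contact Jacobians along $\boldsymbol{n}_i$ and $\boldsymbol{d}_{i,j}$. Let $$\boldsymbol{\beta}^+=(\beta^+_{i,j})=\max\left(-h\boldsymbol{K}\left(\tilde{\boldsymbol{J}}\boldsymbol{Q}^{-1}\boldsymbol{b}+\tilde{\boldsymbol{\phi}}\right),\boldsymbol{0}\right),$$ and define the normal and frictional contact forces at contact $i$ by $$h\boldsymbol{\lambda}^n_{i}:=\Big(\sum_{j=1}^{n_d}\beta^+_{i,j}\Big)\boldsymbol{n}_i,\qquad h\boldsymbol{\lambda}^d_{i}:=\mu_i\sum_{j=1}^{n_d}\beta^+_{i,j}\boldsymbol{d}_{i,j}.$$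 Then the Coulomb friction law holds at every contact: for all $i\in\{1,\dots,n_c\}$, $$\mu_i\,\|\boldsymbol{\lambda}^n_{i}\|\ \geq\ \|\boldsymbol{\lambda}^d_{i}\|.$$
   Context: $\max(\cdot,\boldsymbol 0)$ is componentwise; components of vectors in $\mathbb{R}^m$ are indexed by pairs $(i,j)$ with $1\le i\le n_c$, $1\le j\le n_d$; $\|\cdot\|$ is the Euclidean norm. The vector $\tilde{\boldsymbol\phi}$ has $(i,j)$ entry $\phi_i$, the normal distance at contact $i$. The time-stepping contact model in question is $\boldsymbol v^+=\frac1h\boldsymbol Q^{-1}\boldsymbol b+\frac{1}{h^2}\boldsymbol Q^{-1}\tilde{\boldsymbol J}^{\mathsf T}\boldsymbol\beta^+$, with $\boldsymbol\beta^+$ playing the role of the contact impulse. *)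

(* Defs.v *)
From HB Require Import structures.
From mathcomp Require Import all_boot all_order all_algebra.
From mathcomp Require Import reals.

Set Implicit Arguments.
Unset Strict Implicit.
Unset Printing Implicit Defensive.

Import Order.TTheory GRing.Theory Num.Theory.

Local Open Scope ring_scope.

Definition dotv (R : realType) (p : nat) (u v : 'cV[R]_p) : R :=
  (u^T *m v) 0 0.

(* The library norm on real matrices is the sup norm, hence this one. *)
Definition enorm (R : realType) (p : nat) (u : 'cV[R]_p) : R :=
  Num.sqrt (dotv u u).

(* Symmetry is not part of this predicate. *)
Definition posdefmx (R : realType) (p : nat) (A : 'M[R]_p) : Prop :=
  forall x : 'cV[R]_p, x != 0 -> 0 < dotv x (A *m x).

Definition max0_mx (R : realType) (p q : nat) (A : 'M[R]_(p, q)) : 'M[R]_(p, q) :=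
  map_mx (fun x => Num.max x 0) A.

(* J maps a generalized velocity w to the relative velocity J *m w in R^3 at
   the contact; its component along u is (jacobian_along J u) *m w. *)
Definition jacobian_along (R : realType) (n : nat) (J : 'M[R]_(3, n))
    (u : 'cV[R]_3) : 'rV[R]_n :=
  u^T *m J.

(* Main.v *)
(** The impulses [beta] are nonnegative because of the componentwise maximum, so
    the normal force has norm [(\sum_j beta i j) / h], while the triangle
    inequality over unit vectors bounds the norm of the friction force by
    [mu i] times the same quantity. *)

Require Import Defs.
From HB Require Import structures.
From mathcomp Require Import all_boot all_order all_algebra.
From mathcomp Require Import reals.
From mathcomp Require Import ring.
Import Order.TTheory GRing.Theory Num.Theory.
Local Open Scope ring_scope.

Lemma dotvE {R : realType} {p : nat} (u v : 'cV[R]_p) :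
  dotv u v = \sum_i u i 0 * v i 0.
Proof. by rewrite /dotv mxE; apply: eq_bigr => i _; rewrite mxE. Qed.

Lemma dotvC {R : realType} {p : nat} (u v : 'cV[R]_p) : dotv u v = dotv v u.
Proof. by rewrite !dotvE; apply: eq_bigr => i _; rewrite mulrC. Qed.

Lemma dotvDr {R : realType} {p : nat} (u v w : 'cV[R]_p) :
  dotv u (v + w) = dotv u v + dotv u w.
Proof. by rewrite /dotv mulmxDr mxE. Qed.

Lemma dotvZr {R : realType} {p : nat} (a : R) (u v : 'cV[R]_p) :
  dotv u (a *: v) = a * dotv u v.
Proof. by rewrite /dotv -scalemxAr mxE. Qed.

Lemma dotvDl {R : realType} {p : nat} (u v w : 'cV[R]_p) :
  dotv (u + v) w = dotv u w + dotv v w.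
Proof. by rewrite dotvC dotvDr !(dotvC w). Qed.

Lemma dotvZl {R : realType} {p : nat} (a : R) (u v : 'cV[R]_p) :
  dotv (a *: u) v = a * dotv u v.
Proof. by rewrite dotvC dotvZr dotvC. Qed.

Lemma dotvv_ge0 {R : realType} {p : nat} (u : 'cV[R]_p) : 0 <= dotv u u.
Proof. by rewrite dotvE sumr_ge0 // => i _; rewrite -expr2 sqr_ge0. Qed.

Lemma dotvv_eq0 {R : realType} {p : nat} (u : 'cV[R]_p) :
  dotv u u = 0 -> u = 0.
Proof.
move/eqP; rewrite dotvE psumr_eq0 => [/allP u0|i _]; last by rewrite -expr2 sqr_ge0.
apply/colP => i; rewrite mxE; have := u0 i (mem_index_enum i).
by rewrite mulf_eq0 orbb => /eqP.
Qed.

Lemma enorm_ge0 {R : realType} {p : nat} (u : 'cV[R]_p) : 0 <= enorm u.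
Proof. exact: sqrtr_ge0. Qed.

Lemma sqr_enorm {R : realType} {p : nat} (u : 'cV[R]_p) :
  enorm u ^+ 2 = dotv u u.
Proof. by rewrite sqr_sqrtr // dotvv_ge0. Qed.

Lemma enorm0 {R : realType} {p : nat} : enorm (0 : 'cV[R]_p) = 0.
Proof. by rewrite /enorm /dotv mulmx0 mxE sqrtr0. Qed.

Lemma enormZ {R : realType} {p : nat} (a : R) (u : 'cV[R]_p) :
  enorm (a *: u) = `|a| * enorm u.
Proof.
by rewrite /enorm dotvZl dotvZr mulrA -expr2 sqrtrM ?sqr_ge0 // sqrtr_sqr.
Qed.

(** Cauchy-Schwarz, in squared form to stay free of square roots: the residual of a projection has
    nonnegative squared length. *)
Lemma dotv_sqr_le {R : realType} {p : nat} (u v : 'cV[R]_p) :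
  dotv u v ^+ 2 <= dotv u u * dotv v v.
Proof.
(* The case [v = 0] is split off because the factor [dotv v v] is cancelled at the end. *)
have [v0|v_neq0] := eqVneq (dotv v v) 0.
  by rewrite v0 mulr0 (dotvv_eq0 _ v0) /dotv mulmx0 mxE expr0n.
have v_gt0 : 0 < dotv v v by rewrite lt_def v_neq0 dotvv_ge0.
(* the residual of the projection of u onto the line of v, scaled by dotv v v *)
have := dotvv_ge0 (dotv v v *: u + - dotv u v *: v).
rewrite !(dotvDl, dotvDr, dotvZl, dotvZr) (dotvC v u).
set x := dotv u u; set y := dotv v v in v_gt0 *; set z := dotv u v.
(* The squared length of the residual carries a factor [y > 0]; the other factor is the
   Cauchy-Schwarz gap. *)
rewrite [X in 0 <= X](_ : _ = y * (x * y - z ^+ 2)); last by ring.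
by rewrite pmulr_rge0 // subr_ge0.
Qed.

Lemma dotv_le_enorm {R : realType} {p : nat} (u v : 'cV[R]_p) :
  dotv u v <= enorm u * enorm v.
Proof.
rewrite -sqrtrM ?dotvv_ge0 // (le_trans (ler_norm _)) // -sqrtr_sqr.
exact/ler_wsqrtr/dotv_sqr_le.
Qed.

(** Both sides are nonnegative, so their squares are compared; once the squared norms cancel, only
    the cross terms remain, and Cauchy-Schwarz orders them. *)
Lemma ler_enormD {R : realType} {p : nat} (u v : 'cV[R]_p) :
  enorm (u + v) <= enorm u + enorm v.
Proof.
rewrite -ler_sqr ?nnegrE ?addr_ge0 ?enorm_ge0 // sqrrD !sqr_enorm.
rewrite dotvDl !dotvDr (dotvC v u) addrA lerD2r -addrA lerD2l -mulr2n.
by rewrite lerMn2r dotv_le_enorm.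
Qed.

Lemma ler_enorm_sum {R : realType} {p : nat} {I : finType}
    (F : I -> 'cV[R]_p) :
  enorm (\sum_i F i) <= \sum_i enorm (F i).
Proof.
(* The relation [enorm u <= x] is carried through both sums at once. *)
elim/big_ind2: _ => [|u x v y ux vy|//]; first by rewrite enorm0.
exact: le_trans (ler_enormD _ _) (lerD ux vy).
Qed.

Theorem mainTheorem3 (R : realType) (n nc nd : nat)
    (hn : (0 < n)%N) (hnc : (0 < nc)%N) (hnd : (0 < nd)%N)
    (h : R) (hh : 0 < h)
    (Q : 'M[R]_n) (hQsym : Q^T = Q) (hQ : posdefmx Q)
    (b : 'cV[R]_n)
    (phi : 'I_nc -> R) (phit : 'cV[R]_(nc * nd))
    (hphit : forall (i : 'I_nc) (j : 'I_nd), phit (mxvec_index i j) 0 = phi i)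
    (K : 'M[R]_(nc * nd)) (hKdiag : is_diag_mx K) (hK : posdefmx K)
    (mu : 'I_nc -> R) (hmu : forall i, 0 <= mu i)
    (nv : 'I_nc -> 'cV[R]_3) (hnv : forall i, enorm (nv i) = 1)
    (d : 'I_nc -> 'I_nd -> 'cV[R]_3)
    (hd : forall i j, enorm (d i j) = 1)
    (hdtan : forall i j, dotv (nv i) (d i j) = 0)
    (J : 'I_nc -> 'M[R]_(3, n))
    (Jn : 'I_nc -> 'rV[R]_n)
    (hJn : forall i, Jn i = jacobian_along (J i) (nv i))
    (Jd : 'I_nc -> 'I_nd -> 'rV[R]_n)
    (hJd : forall i j, Jd i j = jacobian_along (J i) (d i j))
    (Jt : 'M[R]_(nc * nd, n))
    (hJt : forall (i : 'I_nc) (j : 'I_nd),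
       row (mxvec_index i j) Jt = Jn i - mu i *: Jd i j)
    (beta : 'cV[R]_(nc * nd))
    (hbeta : beta = max0_mx (- h *: (K *m (Jt *m invmx Q *m b + phit))))
    (lamn lamd : 'I_nc -> 'cV[R]_3)
    (hlamn : forall i : 'I_nc,
       h *: lamn i = (\sum_(j < nd) beta (mxvec_index i j) 0) *: nv i)
    (hlamd : forall i : 'I_nc,
       h *: lamd i = mu i *: \sum_(j < nd) beta (mxvec_index i j) 0 *: d i j) :
  forall i : 'I_nc, mu i * enorm (lamn i) >= enorm (lamd i).
Proof.
move=> i; set s := \sum_(j < nd) beta (mxvec_index i j) 0.
have beta_ge0 j : 0 <= beta (mxvec_index i j) 0.
  by rewrite hbeta mxE le_max lexx orbT.
have s_ge0 : 0 <= s by rewrite sumr_ge0.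
(* Only [h *: lamn i] is specified, so [h] is moved inside the norm as its own absolute value;
   [nv i] is a unit vector and [s] is nonnegative. *)
have normn : h * enorm (lamn i) = s.
  by rewrite -[h in LHS]gtr0_norm // -enormZ hlamn enormZ hnv mulr1 ger0_norm.
(* Scaling by [h > 0] turns forces into impulses: the right side becomes [mu i * s]. *)
rewrite -(ler_pM2l hh) mulrCA normn -[h]gtr0_norm // -enormZ hlamd enormZ.
rewrite ger0_norm // ler_wpM2l // (le_trans (ler_enorm_sum _)) //.
(* Each summand has norm exactly its [beta] entry, so the bounds add up to [s]. *)
by apply: ler_sum => j _; rewrite enormZ hd mulr1 ger0_norm.
Qed.
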